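(* Under the setting of the context, let $f_1,\dots,f_K\in\mathcal C(\mathcal Y)$ be congruent, i.e. $\sum_{k=1}^K\lambda_k f_k\equiv 0$ on $\mathcal Y$. Then $$\mathcal L^*-\mathcal L(f_1,\dots,f_K)=\epsilon\sum_{k=1}^K\lambda_k\,\mathrm{KL}(\pi_k^*\,\|\,\pi^{f_k})\;\ge\;\epsilon\sum_{k=1}^K\lambda_k\,\mathrm{KL}(\mathbb Q^*\,\|\,\mathbb Q^{f_k}).$$
   Context: Let $K\ge 1$. For $k=1,\dots,K$ let $\mathcal X_k\subset\mathbb R^{D_k}$ be compact, and let $\mathcal Y\subset\mathbb R^{D}$ be compact with positive Lebesgue measure. Let $\mathbb P_k$ be an absolutely continuous Borel probability measure on $\mathcal X_k$. Let $c_k:\mathcal X_k\times\mathcal Y\to\mathbb R$ be continuous. Fix weights $\lambda_k>0$ with $\sum_k\lambda_k=1$ and fix $\epsilon>0$. For $\mu\in\mathcal P(\mathcal Y)$, the differential entropy is $H(\mu)=-\int\log\frac{d\mu}{dy}\,d\mu$ if $\mu$ is absolutely continuous, and $-\infty$ otherwise. Define $$\mathrm{EOT}_{c,\epsilon}(\mathbb P,\mathbb Q)=\min_{\pi\in\Pi(\mathbb P,\mathbb Q)}\Big\{\int c\,d\pi-\epsilon\int H(\pi(\cdot\mid x))\,d\mathbb P(x)\Big\},$$ where $\Pi(\mathbb P,\mathbb Q)$ is the set of couplings and $\pi(\cdot\mid x)$ is the conditional of $\pi$ given the first coordinate. The barycenter value is $$\mathcal L^*=\inf_{\mathbb Q\in\mathcal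 P(\mathcal Y)}\sum_k\lambda_k\,\mathrm{EOT}_{c_k,\epsilon}(\mathbb P_k,\mathbb Q).$$ Assume this is finite for some $\mathbb Q$. Then the infimum is attained at a unique $\mathbb Q^*$, the barycenter. $\pi_k^*\in\Pi(\mathbb P_k,\mathbb Q^* )$ denotes the (unique) minimizer in $\mathrm{EOT}_{c_k,\epsilon}(\mathbb P_k,\mathbb Q^* )$. For $f\in\mathcal C(\mathcal Y)$, the weak entropic $c_k$-transform is $$f^{C_k}(x)=\inf_{\mu\in\mathcal P(\mathcal Y)}\Big\{\int c_k(x,y)\,d\mu-\epsilon H(\mu)-\int f\,d\mu\Big\}=-\epsilon\log Z_{c_k}(f,x),$$ where $Z_{c_k}(f,x)=\int_{\mathcal Y}\exp\big((f(y)-c_k(x,y))/\epsilon\big)\,dy$. Further definitions: - $\mathcal L(f_1,\dots,f_K)=\sum_k\lambda_k\int f_k^{C_k}\,d\mathbb P_k$. - $\mu^{f}_{x}$ is the probability measure on $\mathcal Y$ with density $Z_{c_k}(f,x)^{-1}\exp\big((f(y)-c_k(x,y))/\epsilon\big)$. - $\pi^{f_k}$ is the probability measure on $\mathcal X_k\times\mathcal Y$ given by $d\pi^{f_k}(x,y)=d\mu^{f_k}_x(y)\,d\mathbb P_k(x)$. - $\mathbb Q^{f_k}$ is the second marginal of $\pi^{f_k}$. - $\mathrm{KL}$ denotes the Kullback–Leibler divergence. *)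

(* Defs.v *)
From HB Require Import structures.
From mathcomp Require Import all_boot all_order all_algebra.
From mathcomp Require Import all_classical all_reals all_analysis.
From mathcomp Require Import measurable_realfun.

Set Implicit Arguments.
Unset Strict Implicit.
Unset Printing Implicit Defensive.
Import Order.TTheory GRing.Theory Num.Theory.
Import numFieldNormedType.Exports.
Local Open Scope classical_set_scope.
Local Open Scope ring_scope.

Section vec.
Variables (R : realType) (n : nat).

Definition vec := 'rV[R]_n.
HB.instance Definition _ := Topological.on vec.
HB.instance Definition _ := Pointed.on vec.

Let borel := <<s [set: vec], @open vec >>.

Let borelC (A : set vec) : borel A -> borel (~` A).
Proof. by move=> bA; rewrite -setTD; exact: sigma_algebraCD. Qed.

HB.instance Definition _ := @isMeasurable.Build default_measure_display vec
  borel (@sigma_algebra0 _ setT _) borelC (@sigma_algebra_bigcup _ setT _).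

End vec.

Local Open Scope ereal_scope.

(* A measure on R^n is (the) Lebesgue measure iff it gives every box  *)
(* ]a,b] its volume; boxes generate the Borel sets, so such a measure *)
(* is unique (and it exists).                                         *)
Definition is_lebesgue (R : realType) (n : nat)
    (mu : {measure set (vec R n) -> \bar R}) : Prop :=
  forall a b : 'rV[R]_n, (forall i, a ord0 i <= b ord0 i)%R ->
    mu [set x : vec R n | forall i, (a ord0 i < x ord0 i <= b ord0 i)%R]
    = (\prod_(i < n) (b ord0 i - a ord0 i))%:E.

Section info.
Context (R : realType).

Definition is_density d (T : measurableType d) (mu nu : set T -> \bar R)
    (g : T -> R) : Prop :=
  measurable_fun setT g /\ (forall x, (0 <= g x)%R) /\
  forall A, measurable A -> mu A = \int[nu]_(x in A) (g x)%:E.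

Definition KL d (T : measurableType d) (mu nu : set T -> \bar R) : \bar R :=
  match pselect (exists g, is_density mu nu g) with
  | left h => \int[mu]_x (ln (proj1_sig (cid h) x))%:E
  | right _ => +oo
  end.

Definition diff_entropy (n : nat) (leb : set (vec R n) -> \bar R)
    (mu : set (vec R n) -> \bar R) : \bar R :=
  match pselect (exists g, is_density mu leb g) with
  | left h => - \int[mu]_x (ln (proj1_sig (cid h) x))%:E
  | right _ => -oo
  end.

Variables (m n : nat).
Local Notation TX := (vec R m).
Local Notation TY := (vec R n).

Definition is_coupling (P : probability TX R) (Q : probability TY R)
    (pi : probability (TX * TY)%type R) : Prop :=
  (forall A, measurable A -> pi (A `*` setT) = P A) /\
  (forall B, measurable B -> pi (setT `*` B) = Q B).

Definition is_conditional (P : probability TX R)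
    (pi : probability (TX * TY)%type R) (kappa : TX -> probability TY R) : Prop :=
  (forall B, measurable B -> measurable_fun [set: TX] (fun x => kappa x B : \bar R)) /\
  (forall E, measurable E -> pi E = \int[P]_x kappa x (xsection E x)).

Variables (leb : set TY -> \bar R) (X : set TX) (Y : set TY)
  (c : TX * TY -> R) (eps : R).

(* int c dpi - eps int H(pi(.|x)) dP(x) *)
Definition EOT_obj (P : probability TX R) (pi : probability (TX * TY)%type R)
  : \bar R :=
  ereal_inf [set \int[pi]_(z in X `*` Y) (c z)%:E
                 - eps%:E * \int[P]_x diff_entropy leb (kappa x)
            | kappa in [set kappa | is_conditional P pi kappa]].

Definition EOT (P : probability TX R) (Q : probability TY R) : \bar R :=
  ereal_inf [set EOT_obj P pi | pi in [set pi | is_coupling P Q pi]].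

Definition Zc (f : TY -> R) (x : TX) : \bar R :=
  \int[leb]_(y in Y) (expR ((f y - c (x, y)) / eps))%:E.

Definition ctransform (f : TY -> R) (x : TX) : R :=
  (- eps * ln (fine (Zc f x)))%R.

Definition mu_dens (f : TY -> R) (x : TX) (y : TY) : R :=
  (expR ((f y - c (x, y)) / eps) / fine (Zc f x))%R.

Definition pi_f (P : probability TX R) (f : TY -> R) : set (TX * TY) -> \bar R :=
  fun E => \int[P]_x (\int[leb]_(y in Y `&` xsection E x) (mu_dens f x y)%:E).

Definition Q_f (P : probability TX R) (f : TY -> R) : set TY -> \bar R :=
  fun B => pi_f P f (setT `*` B).

End info.

(* Main.v *)
Require Import Defs.
From HB Require Import structures.
From mathcomp Require Import all_boot all_order all_algebra.
From mathcomp Require Import all_classical all_reals all_analysis.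
From mathcomp Require Import measurable_realfun ring lra.
Import Order.TTheory GRing.Theory Num.Theory.
Import numFieldNormedType.Exports.
(** Let nu be the restriction of Lebesgue measure to Y.  If a coupling pi of P
    and Q has finite entropic cost, then pi << P x nu, its conditionals have
    density G(x, .) for almost every x, where G = d pi / d(P x nu), and the cost
    equals int c dpi + eps int ln G dpi.  The measure pi^f has density
    exp((f - c) / eps) / Z(f, x) with respect to the same P x nu, so
    eps KL(pi | pi^f) = cost(pi) - int f^C dP - int f dQ.  This identity needs no
    optimality of pi and no duality; summing it against the weights, the terms
    int f_k dQ cancel because the potentials are congruent.  The inequality is
    the data processing inequality for the projection on the second factor. *)

Set Implicit Arguments.
Unset Strict Implicit.
Unset Printing Implicit Defensive.
Local Open Scope classical_set_scope.
Local Open Scope ring_scope.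
Local Open Scope ereal_scope.

(** The entropy of a conditional is defined through a chosen density, so
    [x |-> diff_entropy leb (kappa x)] is not known to be measurable, although its integral enters
    the cost. Integrals are therefore compared almost everywhere without measurability, and the
    entropy is traded for a Tonelli integral of G once G exists. The cost is moreover an infimum
    over all versions [kappa] of the conditional; one G serves them all. The finiteness of nu gives
    access to Radon-Nikodym and Fubini and controls the negative part of ln G, whose integral is at
    most nu(Y) because t (ln t)^- <= 1. Hence no -oo arises, a finite barycenter value makes every
    term finite, and the gap identity is one between real numbers. Continuity is given on compact
    sets only, so c and f are set to 0 outside them, which makes them bounded and measurable. *)

(** * Comparison of integrals of arbitrary functions *)

Section integral_without_measurability.
Context d (T : measurableType d) (R : realType).
Variable mu : {measure set T -> \bar R}.
Import HBNNSimple.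

(** A simple function below [f], set to 0 on the exceptional set, lies below [g] everywhere and
    keeps its integral; the integral is the supremum over such functions. *)
Lemma ae_ge0_le_integralT (f g : T -> \bar R) :
  (forall x, 0 <= f x) -> (forall x, 0 <= g x) ->
  {ae mu, forall x, f x <= g x} -> \int[mu]_x f x <= \int[mu]_x g x.
Proof.
move=> f0 g0 [N [mN muN subN]].
rewrite !ge0_integralTE//; apply: ge_ereal_sup => _ [h hf <-].
pose h' := proj_nnsfun h (measurableC mN).
have h'h : sintegral mu h' = sintegral mu h.
  rewrite -!integralT_nnsfun; apply: ae_eq_integral => //.
  - by apply/measurable_EFinP.
  - by apply/measurable_EFinP.
  exists N; split=> // x /= hx; apply: contrapT => Nx; apply: hx => _.
  by rewrite /h' /= mindicE mem_set// mulr1.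
rewrite -h'h; apply: ereal_sup_ubound; exists h' => // x.
rewrite /h' /= mindicE.
have [xN|xN] := pselect (N x).
  by rewrite memNset ?mulr0 //= => /(_ xN).
rewrite mem_set// mulr1; apply: (le_trans (hf x)); apply: contrapT => fg.
by apply: xN; apply: subN.
Qed.

Lemma ae_le_integral (D : set T) (f g : T -> \bar R) :
  {ae mu, forall x, D x -> f x <= g x} ->
  \int[mu]_(x in D) f x <= \int[mu]_(x in D) g x.
Proof.
move=> fg; rewrite [leLHS]integral_mkcond [leRHS]integral_mkcond.
have {}fg : {ae mu, forall x, (f \_ D) x <= (g \_ D) x}.
  apply: filterS fg => x; rewrite !patchE; case: ifPn => // xD; apply.
  exact/set_mem.
rewrite [leLHS]integralE [leRHS]integralE; apply: leeB.
- apply: ae_ge0_le_integralT => //; apply: filterS fg => x fg.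
  by rewrite !funeposE ge_max !le_max fg lexx orbT.
- apply: ae_ge0_le_integralT => //; apply: filterS fg => x fg.
  by rewrite !funenegE ge_max !le_max leeN2 fg lexx orbT.
Qed.

Lemma eq_ae_integral (D : set T) (f g : T -> \bar R) :
  {ae mu, forall x, D x -> f x = g x} ->
  \int[mu]_(x in D) f x = \int[mu]_(x in D) g x.
Proof.
move=> fg; apply/eqP; rewrite eq_le; apply/andP.
by split; apply: ae_le_integral; apply: filterS fg => x fg Dx; rewrite fg.
Qed.

End integral_without_measurability.

(** * Densities, change of measure, and independence of [KL] from the chosen density *)

Section density.
Context d (T : measurableType d) (R : realType).
Import HBNNSimple.

(** Simple functions have measurable level sets, so the integral sees only values on measurable
    sets. This lets bare set functions such as [pi_f] be exchanged for measures. *)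
Lemma integral_eq_set_fun (mu nu : set T -> \bar R) (D : set T) f :
  (forall A, measurable A -> mu A = nu A) ->
  \int[mu]_(x in D) f x = \int[nu]_(x in D) f x.
Proof.
move=> munu; rewrite /integral; congr (ereal_sup _ - ereal_sup _);
  apply/seteqP; split => _ [h hf <-]; exists h => //; rewrite /sintegral;
  by apply: eq_fsbigr => r _; rewrite munu.
Qed.

(** An equality of predicates, so that rewriting with it inside [KL] carries along the density
    selected by [cid]. *)
Lemma is_density_eq (mu mu' nu nu' : set T -> \bar R) :
  (forall A, measurable A -> mu A = mu' A) ->
  (forall A, measurable A -> nu A = nu' A) ->
  is_density mu nu = is_density mu' nu'.
Proof.
have : forall mu mu' nu nu' : set T -> \bar R,
  (forall A, measurable A -> mu A = mu' A) ->
  (forall A, measurable A -> nu A = nu' A) ->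
  forall g, is_density mu nu g -> is_density mu' nu' g.
  move=> {mu mu' nu nu'} mu mu' nu nu' muE nuE g [mg [g0 gE]].
  split=> //; split=> // A mA; rewrite -muE// gE//.
  exact: integral_eq_set_fun.
move=> imp muE nuE; apply/funext => g; apply/propext.
by split; apply: imp => // A mA; rewrite ?muE ?nuE.
Qed.

Lemma KL_eq (mu mu' nu nu' : set T -> \bar R) :
  (forall A, measurable A -> mu A = mu' A) ->
  (forall A, measurable A -> nu A = nu' A) ->
  KL mu nu = KL mu' nu'.
Proof.
move=> muE nuE; rewrite /KL (is_density_eq muE nuE); case: pselect => // h.
exact: integral_eq_set_fun.
Qed.

Section change_of_variables.
Variables (mu nu : {measure set T -> \bar R}) (g : T -> R).
Hypothesis dg : is_density mu nu g.
Import HBNNSimple.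

Let mg : measurable_fun setT (EFin \o g).
Proof. by apply/measurable_EFinP; have [] := dg. Qed.

Let g0 x : (0 <= g x)%R. Proof. by have [_ []] := dg. Qed.

(** True for indicators by definition of a density, for simple functions by linearity, and in
    general by monotone convergence. *)
Lemma ge0_integral_density (f : T -> \bar R) :
  measurable_fun setT f -> (forall x, 0 <= f x) ->
  \int[mu]_x f x = \int[nu]_x (f x * (g x)%:E).
Proof.
move=> mf f0; pose h := nnsfun_approx measurableT mf.
have cvgh x : (EFin \o h n) x @[n --> \oo] --> f x.
  exact: cvg_nnsfun_approx.
have ndh x a b : (a <= b)%N -> (h a x <= h b x)%R.
  by move=> ab; exact/lefP/nd_nnsfun_approx.
transitivity (limn (fun n => \int[mu]_x (h n x)%:E)).
  rewrite -monotone_convergence//.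
  - by apply: eq_integral => x _; apply/esym/cvg_lim => //; exact: cvgh.
  - by move=> n; exact/measurable_EFinP.
  - by move=> n x _; rewrite lee_fin.
  - by move=> x _ a b ab; rewrite lee_fin ndh.
transitivity (limn (fun n => \int[nu]_x ((h n x)%:E * (g x)%:E))); last first.
  rewrite -monotone_convergence//.
  - apply: eq_integral => x _; apply/cvg_lim => //.
    by apply: cvgeZr => //; exact: cvgh.
  - by move=> n; apply: emeasurable_funM => //; exact/measurable_EFinP.
  - by move=> n x _; rewrite mule_ge0 // lee_fin.
  - by move=> x _ a b ab; rewrite lee_wpmul2r ?lee_fin ?ndh.
congr (limn _); apply/funext => n.
transitivity (\int[mu]_x
   (\sum_(y \in range (h n)) (y * \1_(h n @^-1` [set y]) x)%:E)).
  by apply: eq_integral => t _; rewrite /= fimfunE -fsumEFin.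
rewrite ge0_integral_fsum//; last 2 first.
- by move=> r; apply/measurable_EFinP/measurable_funM.
- by move=> m x _; exact: nnfun_muleindic_ge0.
transitivity (\int[nu]_x (\sum_(y \in range (h n))
    (y * \1_(h n @^-1` [set y]) x)%:E * (g x)%:E)); last first.
  apply: eq_integral => x _.
  rewrite -ge0_mule_fsuml => [|y]; last exact: nnfun_muleindic_ge0.
  by rewrite fsumEFin // -(fimfunE _ x).
rewrite ge0_integral_fsum//; last 2 first.
- move=> r; apply: emeasurable_funM => //.
  by apply/measurable_EFinP/measurable_funM.
- move=> m x _; apply: mule_ge0; last by rewrite lee_fin.
  exact: nnfun_muleindic_ge0.
apply: eq_fsbigr => r rhn.
under eq_integral do rewrite EFinM.
rewrite integralZl_indic_nnsfun//= integral_indic// setIT.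
under [RHS]eq_integral do rewrite EFinM -muleA.
rewrite ge0_integralZl//.
- congr (_ * _); have [_ [_ ->//]] := dg.
  rewrite integral_mkcond; apply: eq_integral => x _.
  by rewrite epatch_indic muleC.
- by apply: emeasurable_funM => //; exact/measurable_EFinP.
- by move=> t _; rewrite mule_ge0 ?lee_fin.
- by move: rhn; rewrite inE => -[t _ <-]; rewrite lee_fin.
Qed.

Lemma density_gt0_ae : {ae mu, forall x, (0 < g x)%R}.
Proof.
have mN : measurable (g @^-1` [set 0%R]).
  by rewrite -[X in measurable X]setTI; have [mg' _] := dg; exact: mg'.
exists (g @^-1` [set 0%R]); split => //.
- have [_ [_ -> //]] := dg.
  by apply: integral0_eq => x /= ->.
- move=> x /= /negP; rewrite -leNgt => gx; apply/eqP.
  by rewrite eq_le gx g0.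
Qed.

Lemma density_dominates : mu `<< nu.
Proof.
apply/null_content_dominatesP => A mA nuA.
have [_ [_ ->//]] := dg; apply: null_set_integral => //.
by apply: measurable_funTS.
Qed.

End change_of_variables.
End density.

Section density_unique.
Context d (T : measurableType d) (R : realType).

Lemma density_unique (mu : probability T R) (nu : {measure set T -> \bar R})
    (g g' : T -> R) : is_density mu nu g -> is_density mu nu g' ->
  {ae nu, forall x, g x = g' x}.
Proof.
move=> [mg [g0 gE]] [mg' [g'0 g'E]].
have ig : nu.-integrable setT (EFin \o g).
  apply/integrableP; split; first exact/measurable_EFinP.
  under eq_integral do rewrite /= ger0_norm//.
  by rewrite -gE// probability_setT ltry.
have : ae_eq nu setT (EFin \o g) (EFin \o g').
  apply: integral_ae_eq => //; first exact/measurable_EFinP.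
  by move=> E _ mE; rewrite -gE// -g'E.
by apply: filterS => x /(_ I) [].
Qed.

(** Two densities agree [nu]-a.e., hence [mu]-a.e. by domination, so the choice made in [KL] is
    immaterial. *)
Lemma KL_density (mu : probability T R) (nu : {measure set T -> \bar R})
    (g : T -> R) : is_density mu nu g -> KL mu nu = \int[mu]_x (ln (g x))%:E.
Proof.
move=> dg; rewrite /KL; case: pselect => [h|]; last by case; exists g.
have dg' := proj2_sig (cid h); apply: eq_ae_integral.
apply: null_dominates_ae_eq (density_dominates dg) _ => //.
by apply: filterS (density_unique dg' dg) => x ->.
Qed.

Lemma density_exists (mu : probability T R) (nu : {measure set T -> \bar R}) :
  nu setT < +oo -> mu `<< nu -> exists g, is_density mu nu g.
Proof.
move=> nuT munu.
(* Restriction to the whole space gives [nu] the structure of a finite measure. *)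
pose nu' : {finite_measure set T -> \bar R} := mfrestr measurableT nuT.
have nu'E A : nu' A = nu A by rewrite /nu'/= /mfrestr /mrestr setIT.
have {}munu : mu `<< nu'.
  apply/null_content_dominatesP => A mA; rewrite [X in X = _ -> _]nu'E.
  by move/null_content_dominatesP : munu; exact.
pose F := Radon_Nikodym_SigmaFinite.f mu nu'.
have F0 := Radon_Nikodym_SigmaFinite.f_ge0 munu.
have Ffin := Radon_Nikodym_SigmaFinite.f_fin_num munu.
exists (fine \o F).
rewrite -(is_density_eq (fun _ _ => erefl) (fun A _ => nu'E A)); split.
  apply: measurableT_comp => //.
  exact: measurable_int (Radon_Nikodym_SigmaFinite.f_integrable munu).
split; first by move=> x; rewrite fine_ge0.
move=> A mA; rewrite (Radon_Nikodym_SigmaFinite.f_integral munu)//.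
by apply: eq_integral => x _; rewrite /= fineK.
Qed.

(** After the change of measure the integrand is t (ln t)^- at t = g x, which is at most 1 because
    ln (1/t) <= 1/t. *)
Lemma integral_negln_density (mu nu : {measure set T -> \bar R}) (g : T -> R) :
  is_density mu nu g -> \int[mu]_x (fun x => (ln (g x))%:E)^\- x <= nu setT.
Proof.
move=> dg; have [mg [g0 _]] := dg.
have mln : measurable_fun setT (fun x => (ln (g x))%:E)^\-.
  apply: measurable_funeneg; apply/measurable_EFinP.
  by apply: measurableT_comp => //; exact: measurable_ln.
rewrite (ge0_integral_density dg)//.
rewrite -[leRHS]mul1e -integral_cst//; apply: ge0_le_integral => //.
- by move=> x _; rewrite mule_ge0// lee_fin.
- by apply: emeasurable_funM => //; exact/measurable_EFinP.
move=> x _ /=; rewrite funenegE -EFinN -EFin_max -EFinM lee_fin.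
have := g0 x; rewrite le_eqVlt => /predU1P[<-|gx]; first by rewrite mulr0.
rewrite maxr_pMl ?g0// mul0r ge_max ler01 andbT.
rewrite -lnV ?posrE// -ler_pdivlMr// mul1r ltW// ln_sublinear//.
by rewrite invr_gt0.
Qed.

End density_unique.

(** * Passing from Lebesgue measure to its restriction *)

Section restriction.
Context d (T : measurableType d) (R : realType).
Variables (leb : {measure set T -> \bar R}) (Y : set T) (mY : measurable Y).

Lemma mrestr_density : is_density (mrestr leb mY) leb (\1_Y).
Proof.
split; first by [].
split=> // A mA; rewrite integral_indic// /mrestr setIC//.
Qed.

Lemma is_density_mrestr (mu : {measure set T -> \bar R}) (g : T -> R) :
  mu (~` Y) = 0 -> is_density mu leb g -> is_density mu (mrestr leb mY) g.
Proof.
move=> muY [mg [g0 gE]]; split=> //; split=> // A mA.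
rewrite integral_mkcond (ge0_integral_density mrestr_density); last 2 first.
- by apply/(measurable_restrictT _ mA)/measurable_funTS/measurable_EFinP.
- by move=> x; rewrite patchE; case: ifP; rewrite // lee_fin.
transitivity (mu (A `&` Y)).
  rewrite (@measureDI _ _ _ mu A Y)// [X in X + _](_ : _ = 0) ?add0e//.
  apply: subset_measure0 muY => //; [exact: measurableD|].
  exact: measurableC.
rewrite gE; last exact: measurableI.
rewrite integral_mkcond; apply: eq_integral => x _.
rewrite !patchE in_setI indicE; case: (x \in A); rewrite ?mul0e//=.
by case: (x \in Y); rewrite ?mule1 ?mule0.
Qed.

(** For [mu] carried by [Y], a density for either reference measure yields one for the other; from
    the restriction to [leb], it is first multiplied by the indicator of [Y]. *)
Lemma KL_mrestr (mu : probability T R) :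
  mu (~` Y) = 0 -> KL mu leb = KL mu (mrestr leb mY).
Proof.
move=> muY; have [[g dg]|no] := pselect (exists g, is_density mu leb g).
  have dg' := is_density_mrestr muY dg.
  rewrite (KL_density dg').
  rewrite /KL; case: pselect => [h|]; last by case; exists g.
  by rewrite -(KL_density (is_density_mrestr muY (proj2_sig (cid h)))) (KL_density dg').
rewrite /KL; case: pselect => // no'; case: pselect => // -[g dg].
case: no; have [mg [g0 gE]] := dg; exists (fun x => g x * \1_Y x)%R.
split; first exact: measurable_funM.
split=> [x|A mA]; first by rewrite mulr_ge0.
rewrite gE//; transitivity
  (\int[(mrestr leb mY : {measure set T -> \bar R})]_(x in A) (g x)%:E) => //.
rewrite [LHS]integral_mkcond (ge0_integral_density mrestr_density); last 2 first.
- by apply/(measurable_restrictT _ mA)/measurable_funTS/measurable_EFinP.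
- by move=> x; rewrite patchE; case: ifP; rewrite // lee_fin.
rewrite [RHS]integral_mkcond; apply: eq_integral => x _.
by rewrite !patchE; case: ifP => //; rewrite mul0e.
Qed.

End restriction.

(** * Data processing inequality *)

Section data_processing.
Context d d' (T : measurableType d) (T' : measurableType d') (R : realType).

Lemma integral_pushforwardT (mu : {measure set T -> \bar R})
    (nu : {measure set T' -> \bar R}) (phi : T -> T') (f : T' -> \bar R) :
  measurable_fun setT phi -> measurable_fun setT f ->
  (forall B, measurable B -> nu B = mu (phi @^-1` B)) ->
  \int[nu]_y f y = \int[mu]_x f (phi x).
Proof.
move=> mphi mf nuE.
have ge0 (g : T' -> \bar R) : measurable_fun setT g -> (forall y, 0 <= g y) ->
    \int[nu]_y g y = \int[mu]_x g (phi x).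
  move=> mg g0; rewrite (integral_eq_set_fun (nu := pushforward mu phi))//.
  by rewrite ge0_integral_pushforward//= preimage_setT.
rewrite [LHS]integralE [RHS]integralE.
rewrite !ge0//; [|exact: measurable_funeneg|exact: measurable_funepos].
by congr (_ - _); apply: eq_integral => x _; rewrite ?funeposE ?funenegE.
Qed.

(** The negative part has finite integral since [nu] is finite, so the upper bound on the integral
    controls the positive part. *)
Lemma integrable_ln_density (mu : probability T R)
    (nu : {finite_measure set T -> \bar R}) (g : T -> R) :
  is_density mu nu g -> \int[mu]_x (ln (g x))%:E < +oo ->
  mu.-integrable setT (fun x => (ln (g x))%:E).
Proof.
move=> dg Ilt; have [mg [g0 gE]] := dg.
have mln : measurable_fun setT (fun x => (ln (g x))%:E).
  by apply/measurable_EFinP; apply: measurableT_comp => //; exact: measurable_ln.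
have nlt : \int[mu]_x (fun x => (ln (g x))%:E)^\- x < +oo.
  apply: (le_lt_trans (integral_negln_density dg)).
  by rewrite ltey_eq fin_num_measure.
have plt : \int[mu]_x (fun x => (ln (g x))%:E)^\+ x < +oo.
  move: Ilt; rewrite integralE -(@fineK _ (\int[mu]_x _^\- x)).
    by rewrite lteBlDr// => /lt_le_trans; apply; rewrite addye// leey.
  by rewrite ge0_fin_numE// integral_ge0.
apply/integrableP; split=> //.
rewrite (eq_integral
  ((fun x => (ln (g x))%:E)^\+ \+ (fun x => (ln (g x))%:E)^\-)); last first.
  by move=> x _; rewrite -[RHS]/((_ \+ _) x) -fune_abse.
rewrite ge0_integralD//; [exact: lte_add_pinfty| |].
- exact: measurable_funepos.
- exact: measurable_funeneg.
Qed.

(** With [q] a density of the image measures and h = (q o phi) / g, one has ln (q o phi) - ln g = ln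
    h <= h - 1 almost everywhere, and [h] has [mu]-integral at most 1. *)
Lemma KL_pushforward_le (mu : probability T R)
    (nu : {finite_measure set T -> \bar R}) (mu' : probability T' R)
    (nu' : set T' -> \bar R) (phi : T -> T') :
  measurable_fun setT phi ->
  (forall B, measurable B -> mu' B = mu (phi @^-1` B)) ->
  (forall B, measurable B -> nu' B = nu (phi @^-1` B)) ->
  KL mu' nu' <= KL mu nu.
Proof.
move=> mphi muE nu_E.
pose nu1 := (pushforward nu phi : {measure set T' -> \bar R}).
have [nu0 nuE] : exists nu0 : {measure set T' -> \bar R},
    forall B, measurable B -> nu0 B = nu (phi @^-1` B).
  by exists (nu1 mphi).
rewrite (KL_eq (nu := nu') (nu' := nu0) (fun _ _ => erefl)); last first.
  by move=> B mB; rewrite nuE// nu_E.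
have [[g dg]|no] := pselect (exists g, is_density mu nu g); last first.
  by rewrite [leRHS]/KL; case: pselect => [/no//|_]; rewrite leey.
have mpre B : measurable B -> measurable (phi @^-1` B).
  by move=> mB; rewrite -[X in measurable X]setTI; exact: mphi.
have [q dq] : exists q, is_density mu' nu0 q.
  apply: density_exists; first by rewrite nuE// preimage_setT ltey_eq fin_num_measure.
  apply/null_content_dominatesP => B mB nu0B.
  have nuB : nu (phi @^-1` B) = 0 by rewrite -nuE.
  rewrite muE//; have /null_content_dominatesP := density_dominates dg.
  by apply => //; exact: mpre.
rewrite (KL_density dq) (KL_density dg).
have [Ioo|] := eqVneq (\int[mu]_x (ln (g x))%:E) +oo.
  by rewrite Ioo leey.
rewrite -ltey => Ilt.
have iL := integrable_ln_density dg Ilt.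
have [mg [g0 _]] := dg; have [mq [q0 _]] := dq.
have mln : measurable_fun [set: R] (@ln R) by exact: measurable_ln.
have mqphi : measurable_fun setT (q \o phi) by exact: measurableT_comp.
rewrite (integral_pushforwardT mphi _ muE); last first.
  by apply/measurable_EFinP; exact: measurableT_comp.
(* The quotient (q o phi) / g, in a form that is positive wherever q o phi is; the zero set of [g]
   is [mu]-null. *)
pose h x := (q (phi x) * expR (- ln (g x)))%R.
have h0 x : (0 <= h x)%R by rewrite mulr_ge0// expR_ge0.
have mh : measurable_fun setT h.
  apply: measurable_funM => //; apply: measurableT_comp; first exact: measurable_expR.
  by apply: measurable_funN; exact: measurableT_comp.
have Ih : \int[mu]_x (h x)%:E <= 1.
  rewrite (ge0_integral_density dg)//; last exact/measurable_EFinP.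
  rewrite -(@probability_setT _ _ _ mu'); have [_ [_ ->//]] := dq.
  rewrite (integral_pushforwardT mphi _ nuE); last exact/measurable_EFinP.
  apply: ge0_le_integral => //.
  - by move=> x _; rewrite mule_ge0// lee_fin.
  - apply: emeasurable_funM; exact/measurable_EFinP.
  - by apply/measurable_EFinP.
  move=> x _; rewrite -EFinM lee_fin /h; have := g0 x.
  rewrite le_eqVlt => /predU1P[<-|gx]; first by rewrite mulr0.
  by rewrite expRN lnK ?posrE// mulfVK// gt_eqF.
have ih : mu.-integrable setT (EFin \o h).
  apply/integrableP; split; first exact/measurable_EFinP.
  under eq_integral do rewrite /= ger0_norm//.
  by rewrite (le_lt_trans Ih)// ltry.
have i1 : mu.-integrable setT (EFin \o cst 1%R).
  by apply: finite_measure_integrable_cst.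
apply: (@le_trans _ _ (\int[mu]_x ((ln (g x))%:E + ((h x)%:E - 1)))).
  apply: ae_le_integral.
  have : {ae mu, forall x, (0 < q (phi x))%R}.
    have [N [mN N0 sub]] := density_gt0_ae dq.
    exists (phi @^-1` N); split; [exact: mpre|by rewrite -muE|].
    by move=> x /= /sub.
  apply: filterS2 (density_gt0_ae dg) => x gx qx _.
  rewrite -EFinB -EFinD lee_fin -lerBlDl lerBrDl.
  apply: (le_trans (expR_ge1Dx _)).
  by rewrite expRD /h lnK ?posrE.
rewrite integralD//; last exact: integrableB.
rewrite integralB//= integral_cst// mul1e.
rewrite -[leRHS]adde0 leeD2l// [X in _ - X](_ : _ = 1) ?sube_le0//.
exact: probability_setT.
Qed.

End data_processing.

Section measure_of_density.
Context d (T : measurableType d) (R : realType).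
Variables (mu : {measure set T -> \bar R}) (g : T -> R).

Lemma measure_of_density : measurable_fun setT g -> (forall x, (0 <= g x)%R) ->
  \int[mu]_x (g x)%:E < +oo ->
  exists nu : {finite_measure set T -> \bar R}, is_density nu mu g.
Proof.
move=> mg g0 ig; pose nu A := \int[mu]_(x in A) (g x)%:E.
have nu0 : nu set0 = 0 by rewrite /nu integral_set0.
have nu_ge0 A : 0 <= nu A by apply: integral_ge0 => x _; rewrite lee_fin.
have nu_add : semi_sigma_additive nu.
  move=> F mF tF mUF; rewrite /nu ge0_integral_bigcup//.
  - by apply: is_cvg_ereal_nneg_natsum => n _; apply: integral_ge0 => x _;
      rewrite lee_fin.
  - by apply: measurable_funTS; exact/measurable_EFinP.
  - by move=> x _; rewrite lee_fin.
pose m1 := isMeasure.Build _ _ _ nu nu0 nu_ge0 nu_add.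
pose n1 : {measure set T -> \bar R} := HB.pack nu m1.
have fin : fin_num_fun n1.
  move=> A mA; rewrite ge0_fin_numE//; apply: le_lt_trans ig.
  apply: ge0_subset_integral => //; first exact/measurable_EFinP.
  by move=> x _; rewrite lee_fin.
pose m2 := Measure_isFinite.Build _ _ _ n1 fin.
pose n2 : {finite_measure set T -> \bar R} := HB.pack (Measure.sort n1) m2.
by exists n2.
Qed.

End measure_of_density.

(** * Disintegration and densities of the conditionals *)

Section kernel_xsection.
Context d1 d2 (T1 : measurableType d1) (T2 : measurableType d2) (R : realType).
Variable kappa : T1 -> probability T2 R.
Hypothesis mkappa : forall B, measurable B ->
  measurable_fun setT (fun x => kappa x B : \bar R).

Let k (x : T1) : {measure set T2 -> \bar R} := kappa x.

HB.instance Definition _ := isKernel.Build _ _ T1 T2 R k mkappa.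

Let k1 x : k x setT = 1. Proof. exact: probability_setT. Qed.

HB.instance Definition _ := Kernel_isProbability.Build _ _ T1 T2 R k k1.

Lemma measurable_fun_kernel_xsection (E : set (T1 * T2)) : measurable E ->
  measurable_fun setT (fun x => kappa x (xsection E x)).
Proof.
by move=> mE; apply: (@measurable_fun_xsection_finite_kernel _ _ _ _ _ k);
  rewrite inE.
Qed.

End kernel_xsection.

Section disintegration.
Context d1 d2 (T1 : measurableType d1) (T2 : measurableType d2) (R : realType).
Variables (P : probability T1 R) (nu : {finite_measure set T2 -> \bar R}).
Variable pi : probability (T1 * T2)%type R.
Variable kappa : T1 -> probability T2 R.
Hypothesis mkappa : forall B, measurable B ->
  measurable_fun setT (fun x => kappa x B : \bar R).
Hypothesis piE : forall E, measurable E ->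
  pi E = \int[P]_x kappa x (xsection E x).

Lemma conditional_ae_null (E : set (T1 * T2)) : measurable E -> pi E = 0 ->
  {ae P, forall x, kappa x (xsection E x) = 0}.
Proof.
move=> mE; rewrite piE// => I0.
have /ae_eq_integral_abs : measurable_fun [set: T1] (fun x => kappa x (xsection E x)).
  exact: measurable_fun_kernel_xsection.
move=> /(_ P measurableT)[+ _].
under eq_integral do rewrite gee0_abs//.
by move=> /(_ I0); apply: filterS => x /(_ I).
Qed.

(* Since [e] need not be measurable, the infinite part is bounded from below by
   the measurable function [+oo * kappa x (xsection N x)]. *)
Lemma conditional_dominates (e : T1 -> \bar R) :
  {ae P, forall x, ~ (kappa x `<< nu) -> e x = -oo} ->
  -oo < \int[P]_x e x -> pi `<< (P \x nu).
Proof.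
move=> eoo Ie; apply/null_content_dominatesP => N mN MN.
have mk := measurable_fun_kernel_xsection mkappa mN.
have Ineg : \int[P]_x e^\- x < +oo.
  rewrite ltey; apply/eqP => Ioo; move: Ie.
  by rewrite integralE Ioo addeNy ltxx.
have nuN : {ae P, forall x, nu (xsection N x) = 0}.
  have mnu := measurable_fun_xsection nu mN.
  have /ae_eq_integral_abs : measurable_fun [set: T1] (nu \o xsection N) by [].
  move=> /(_ P measurableT)[+ _].
  under eq_integral do rewrite gee0_abs//.
  by move=> /(_ MN); apply: filterS => x /(_ I).
have : \int[P]_x (+oo * kappa x (xsection N x)) <= \int[P]_x e^\- x.
  apply: ae_ge0_le_integralT => // [x|]; first by rewrite mule_ge0.
  apply: filterS2 nuN eoo => x nuN eoo.
  have [->|k0] := eqVneq (kappa x (xsection N x)) 0; first by rewrite mule0.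
  rewrite funenegE eoo ?maxye ?leey// => /null_content_dominatesP dom.
  by move/eqP: k0; apply; apply: dom => //; exact: measurable_xsection.
rewrite ge0_integralZl//= -piE//.
have [->//|pi0] := eqVneq (pi N) 0.
by rewrite gt0_mulye ?lt0e ?pi0 ?measure_ge0// leye_eq => /eqP Ioo; rewrite Ioo in Ineg.
Qed.

Lemma conditional_density_exists (e : T1 -> \bar R) :
  {ae P, forall x, ~ (kappa x `<< nu) -> e x = -oo} ->
  -oo < \int[P]_x e x -> exists G, is_density pi (P \x nu) G.
Proof.
move=> eoo Ie; apply: (density_exists (nu := P \x nu)).
  rewrite /= -setXTT product_measure1E//.
  by rewrite lte_mul_pinfty// ?fin_num_measure// ltey_eq fin_num_measure.
exact: conditional_dominates eoo Ie.
Qed.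

Section density.
Variable G : T1 * T2 -> R.
Hypothesis dG : is_density pi (P \x nu) G.

Let mG : measurable_fun setT G. Proof. by have [] := dG. Qed.
Let G0 z : (0 <= G z)%R. Proof. by have [_ []] := dG. Qed.

Let mGx x : measurable_fun setT (fun y => G (x, y)).
Proof. exact: measurableT_comp. Qed.

(** Integrated over any measurable A, both sides give pi (A x B), by disintegration and by Tonelli.
    The exceptional set still depends on [B]. *)
Lemma conditional_density_at (B : set T2) : measurable B ->
  {ae P, forall x, kappa x B = \int[nu]_(y in B) (G (x, y))%:E}.
Proof.
move=> mB.
have mF : measurable_fun [set: T1 * T2] ((EFin \o G) \_ (setT `*` B)).
  apply/(measurable_restrictT _ _).1/measurable_funTS/measurable_EFinP => //.
  exact: measurableX.
have F0 z : 0 <= ((EFin \o G) \_ (setT `*` B)) z.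
  by rewrite patchE; case: ifP => //= _; rewrite lee_fin.
have FE x : \int[nu]_(y in B) (G (x, y))%:E =
    fubini_F nu ((EFin \o G) \_ (setT `*` B)) x.
  rewrite integral_mkcond; apply: eq_integral => y _.
  by rewrite !patchE in_setX in_setT.
have : ae_eq P setT (fun x => kappa x B)
    (fun x => \int[nu]_(y in B) (G (x, y))%:E).
  apply: integral_ae_eq => //.
  - apply/integrableP; split; first exact: mkappa.
    under eq_integral do rewrite gee0_abs//.
    apply: (@le_lt_trans _ _ (\int[P]_x 1)); last first.
      rewrite integral_cst// mul1e.
      by apply: (le_lt_trans (probability_le1 P measurableT)); rewrite ltry.
    apply: ge0_le_integral => //; first exact: mkappa.
    by move=> x _; exact: probability_le1.
  - by rewrite (funext FE); exact: measurable_fun_fubini_tonelli_F.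
  move=> A _ mA; transitivity (pi (A `*` B)).
    rewrite piE; last exact: measurableX.
    rewrite integral_mkcond; apply: eq_integral => x _; rewrite patchE.
    case: ifPn => xA; first by rewrite in_xsectionX.
    by rewrite notin_xsectionX// measure0.
  have [_ [_ ->]] := dG; last exact: measurableX.
  rewrite [LHS]integral_mkcond [LHS]fubini_tonelli1//=; last 2 first.
  - apply/(measurable_restrictT _ _).1/measurable_funTS/measurable_EFinP => //.
    exact: measurableX.
  - by move=> z; rewrite patchE; case: ifP => //= _; rewrite lee_fin.
  rewrite [RHS]integral_mkcond; apply: eq_integral => x _.
  rewrite /fubini_F patchE; case: ifPn => xA.
    rewrite [RHS]integral_mkcond; apply: eq_integral => y _.
    by rewrite !patchE in_setX xA.
  by apply: integral0_eq => y _; rewrite patchE in_setX (negbTE xA).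
by apply: filterS => x /(_ I).
Qed.

(** Countability of the generating pi-system merges the exceptional sets into one null set; off it,
    Dynkin induction reaches every measurable set. *)
Lemma conditional_density (B : nat -> set T2) :
  @measurable _ T2 = <<s range B >> -> setI_closed (range B) ->
  {ae P, forall x, is_density (kappa x) nu (fun y => G (x, y))}.
Proof.
move=> BE BI.
have mB n : measurable (B n) by rewrite BE; apply: sub_gen_smallest; exists n.
have := ae_foralln (fun n => conditional_density_at (mB n)).
(* The whole space may lie outside the family, so its mass is recorded separately; it also bounds
   the integrals over smaller sets. *)
apply: filterS2 (conditional_density_at measurableT) => x kT kB.
split; first exact: mGx.
split=> // A; rewrite {1}BE.
have mGE D : measurable_fun D (fun y => (G (x, y))%:E).
  by apply/measurable_funTS/measurable_EFinP.
have fin S : measurable S -> \int[nu]_(y in S) (G (x, y))%:E \is a fin_num.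
  move=> mS; rewrite ge0_fin_numE; last by apply: integral_ge0 => y _; rewrite lee_fin.
  apply: (@le_lt_trans _ _ (\int[nu]_y (G (x, y))%:E)).
    by apply: ge0_subset_integral => // y _; rewrite lee_fin.
  by rewrite -kT probability_setT ltry.
move: A; apply: (dynkin_induction BE BI) => //.
- by move=> _ [n _ <-]; exact: kB.
- move=> S mS kS.
  have : kappa x S + kappa x (~` S) =
      \int[nu]_(y in S) (G (x, y))%:E + \int[nu]_(y in ~` S) (G (x, y))%:E.
    rewrite -measureU//; [|exact: measurableC|by rewrite setICr].
    rewrite -ge0_integral_setU//; [|exact: measurableC| |].
    - by rewrite setUCr.
    - by move=> y _; rewrite lee_fin.
    - by rewrite disj_set2E setICr.
  rewrite -kS ![kappa x S + _]addeC => /(congr1 (fun u => u - kappa x S)).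
  by rewrite !addeK// kS fin.
- move=> F mF tF kF; rewrite measure_bigcup//= ge0_integral_bigcup//.
  - rewrite (eq_eseriesr (fun n _ => kF n)).
    by apply: eq_eseriesl => n; rewrite in_setT.
  - by move=> y _; rewrite lee_fin.
Qed.

End density.
End disintegration.

(** * Relative entropy: lower bound, exponential densities, chain rule *)

Section relative_entropy.
Context d (T : measurableType d) (R : realType).

Lemma KL_ge (mu : probability T R) (nu : {measure set T -> \bar R}) :
  - nu setT <= KL mu nu.
Proof.
have [[g dg]|no] := pselect (exists g, is_density mu nu g); last first.
  by rewrite [leRHS]/KL; case: pselect => [/no//|_]; rewrite leey.
rewrite (KL_density dg) integralE -[leLHS]add0e; apply: leeB.
  exact: integral_ge0.
exact: integral_negln_density.
Qed.

(** An exponential never vanishes, so [mu] has density g exp(- theta) relative to [nu]; its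
    logarithm splits where g > 0, that is [mu]-a.e. *)
Lemma KL_exp_density (mu : probability T R) (M nu : {measure set T -> \bar R})
    (g theta : T -> R) : is_density mu M g -> measurable_fun setT theta ->
  is_density nu M (expR \o theta) ->
  KL mu nu = \int[mu]_x (ln (g x) - theta x)%:E.
Proof.
move=> dg mt dn; have [mg [g0 gE]] := dg.
have me : measurable_fun setT (fun x => expR (- theta x)).
  apply: measurableT_comp; first exact: measurable_expR.
  exact: measurable_funN.
have d' : is_density mu nu (fun x => g x * expR (- theta x))%R.
  split; first exact: measurable_funM.
  split=> [x|A mA]; first by rewrite mulr_ge0// expR_ge0.
  rewrite integral_mkcond (ge0_integral_density dn); last 2 first.
  - apply/(measurable_restrictT _ mA)/measurable_funTS/measurable_EFinP.
    exact: measurable_funM.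
  - by move=> x; rewrite patchE; case: ifP; rewrite // lee_fin mulr_ge0// expR_ge0.
  rewrite gE// integral_mkcond; apply: eq_integral => x _.
  rewrite !patchE; case: ifP => _; last by rewrite mul0e.
  by rewrite /= -EFinM -mulrA -expRD addNr expR0 mulr1.
rewrite (KL_density d'); apply: eq_ae_integral.
apply: filterS (density_gt0_ae dg) => x gx _.
by rewrite lnM ?posrE ?expR_gt0// expRK.
Qed.

End relative_entropy.

Section chain_rule.
Context d1 d2 (T1 : measurableType d1) (T2 : measurableType d2) (R : realType).
Variables (P : probability T1 R) (nu : {finite_measure set T2 -> \bar R}).
Variable pi : probability (T1 * T2)%type R.
Variable kappa : T1 -> probability T2 R.
Variable G : T1 * T2 -> R.
Hypothesis dG : is_density pi (P \x nu) G.
Hypothesis dkappa : {ae P, forall x, is_density (kappa x) nu (fun y => G (x, y))}.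

Let mG : measurable_fun setT (EFin \o G).
Proof. by apply/measurable_EFinP; have [] := dG. Qed.
Let G0 z : (0 <= G z)%R. Proof. by have [_ []] := dG. Qed.

(** For measurable F >= 0, a version of the integral of F (x, .) under [kappa x] that Tonelli shows
    measurable in x. *)
Let I (F : T1 * T2 -> \bar R) := fubini_F nu (fun z => F z * (G z)%:E).

Let mI F : measurable_fun setT F -> (forall z, 0 <= F z) ->
  measurable_fun setT (I F).
Proof.
move=> mF F0; apply: measurable_fun_fubini_tonelli_F.
- exact: emeasurable_funM.
- by move=> z; rewrite mule_ge0// lee_fin.
Qed.

Let I0 F x : (forall z, 0 <= F z) -> 0 <= I F x.
Proof. by move=> F0; apply: integral_ge0 => y _; rewrite mule_ge0// lee_fin. Qed.

Let integral_I F : measurable_fun setT F -> (forall z, 0 <= F z) ->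
  \int[pi]_z F z = \int[P]_x I F x.
Proof.
move=> mF F0; rewrite (ge0_integral_density dG)// [LHS]fubini_tonelli1//.
- exact: emeasurable_funM.
- by move=> z; rewrite mule_ge0// lee_fin.
Qed.

Let kappa_I F : measurable_fun setT F -> (forall z, 0 <= F z) ->
  {ae P, forall x, \int[kappa x]_y F (x, y) = I F x}.
Proof.
move=> mF F0; apply: filterS dkappa => x dx.
by rewrite (ge0_integral_density dx)//; exact: measurableT_comp.
Qed.

(** With L = ln G, [e] is a.e. equal to the measurable difference of [I L^\-] and [I L^\+]. The
    first is a.e. at most the mass of [nu]; the lower bound on the integral of [e] then makes the
    second integrable, and the difference is integrated termwise. *)
Lemma integral_KL_conditional (e : T1 -> \bar R) :
  {ae P, forall x, e x = - KL (kappa x) nu} -> -oo < \int[P]_x e x ->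
  pi.-integrable setT (fun z => (ln (G z))%:E) /\
  \int[P]_x e x = - \int[pi]_z (ln (G z))%:E.
Proof.
move=> eE; pose L z := (ln (G z))%:E.
have mL : measurable_fun setT L.
  apply/measurable_EFinP; apply: measurableT_comp; first exact: measurable_ln.
  exact/measurable_EFinP.
have mLp := measurable_funepos mL; have mLn := measurable_funeneg mL.
have Hn_le : {ae P, forall x, I L^\- x <= nu setT}.
  apply: filterS2 (kappa_I mLn (funeneg_ge0 L)) dkappa => x <- dx.
  apply: le_trans (integral_negln_density dx).
  rewrite le_eqVlt; apply/orP; left; apply/eqP.
  by apply: eq_integral => y _; rewrite !funenegE.
have nuT : nu setT < +oo by rewrite ltey_eq fin_num_measure.
have IHn : \int[P]_x I L^\- x < +oo.
  apply: (@le_lt_trans _ _ (\int[P]_x nu setT)).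
    apply: ae_ge0_le_integralT => // x; exact: I0.
  rewrite integral_cst//; apply: lte_mul_pinfty => //.
    by rewrite fin_num_measure.
  by apply: (le_lt_trans (probability_le1 P measurableT)); rewrite ltry.
have oppB (a b : \bar R) : a \is a fin_num -> - (a - b) = b - a.
  by case: a b => [a| |] [b| |]// _; rewrite -!EFinB -EFinN opprB.
have oppB' (a b : \bar R) : a \is a fin_num -> - (b - a) = a - b.
  by case: a b => [a| |] [b| |]// _; rewrite -!EFinB -EFinN opprB.
have KLE : {ae P, forall x, KL (kappa x) nu = I L^\+ x - I L^\- x}.
  apply: filterS3 (kappa_I mLp (funepos_ge0 L)) (kappa_I mLn (funeneg_ge0 L))
    dkappa => x <- <- dx.
  rewrite (KL_density dx) integralE; congr (_ - _); apply: eq_integral => y _.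
    by rewrite !funeposE.
  by rewrite !funenegE.
have Hn_fin : {ae P, forall x, I L^\- x \is a fin_num}.
  apply: filterS Hn_le => x /le_lt_trans/(_ nuT) Ilt.
  by rewrite ge0_fin_numE// I0.
have eI : \int[P]_x e x = \int[P]_x (I L^\- x - I L^\+ x).
  apply: eq_ae_integral; apply: filterS3 eE KLE Hn_fin => x -> -> fin _.
  exact: oppB'.
have mIp : measurable_fun setT (I L^\+) by exact: mI.
have mIn : measurable_fun setT (I L^\-) by exact: mI.
rewrite eI => Ilt; pose E x := I L^\- x - I L^\+ x.
have mE : measurable_fun setT E by exact: emeasurable_funB.
have IE : \int[P]_x E^\- x < +oo.
  rewrite ltey; apply/eqP => Ioo; move: Ilt.
  by rewrite integralE Ioo addeNy ltxx.
(* From E = I L^- - I L^+ follows I L^+ <= E^- + I L^-, and both terms have finite integral. *)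
have IHp : \int[P]_x I L^\+ x < +oo.
  apply: (@le_lt_trans _ _ (\int[P]_x (E^\- x + I L^\- x))).
    apply: ae_ge0_le_integralT => [x|x|]; [exact: I0|by rewrite adde_ge0// I0|].
    apply: filterS Hn_fin => x fin; rewrite -leeBlDr// funenegE le_max.
    by rewrite /E (oppB _ _ fin) lexx.
  rewrite ge0_integralD//; first exact: lte_add_pinfty.
  - exact: measurable_funeneg.
  - by move=> x _; exact: I0.
have iIp : P.-integrable setT (I L^\+).
  apply/integrableP; split=> //.
  by under eq_integral do rewrite gee0_abs ?I0//.
have iIn : P.-integrable setT (I L^\-).
  apply/integrableP; split=> //.
  by under eq_integral do rewrite gee0_abs ?I0//.
have IL : \int[pi]_z L z = \int[P]_x I L^\+ x - \int[P]_x I L^\- x.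
  by rewrite integralE !integral_I.
split; last first.
  have fin : \int[P]_x I L^\- x \is a fin_num.
    by rewrite ge0_fin_numE//; apply: integral_ge0 => x _; exact: I0.
  by rewrite integralB// IL (oppB' _ _ fin).
apply/integrableP; split=> //.
rewrite (eq_integral (L^\+ \+ L^\-)); last first.
  by move=> z _; rewrite -[RHS]/((_ \+ _) z) -fune_abse.
by rewrite ge0_integralD//= !integral_I//; exact: lte_add_pinfty.
Qed.
End chain_rule.

(** * A countable pi-system of boxes generating the Borel sets *)

Section rational_boxes.
Variables (R : realType) (n : nat).

Let bounds : countType := option ('rV[rat]_n * 'rV[rat]_n)%type.

(** The code [None] guarantees an index for the empty set, which in dimension 0 no pair of corners
    yields. *)
Definition rational_box (k : nat) : set (vec R n) :=
  if @unpickle bounds k is Some (Some ab) then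
    [set x | forall i, (ratr (ab.1 ord0 i) < x ord0 i < ratr (ab.2 ord0 i))%R]
  else set0.

Lemma nbhs_rational_box (x : vec R n) (U : set (vec R n)) : nbhs x U ->
  exists2 k, rational_box k x & rational_box k `<=` U.
Proof.
move=> [W nW WU].
have bnd j : exists pq : rat * rat, [set t : R | (ratr pq.1 < t < ratr pq.2)%R]
    (x ord0 j) /\
    [set t : R | (ratr pq.1 < t < ratr pq.2)%R] `<=` W ord0 j.
  have /nbhs_ballP[e /= e0 sub] := nW ord0 j.
  have [p] := @rat_in_itvoo R (x ord0 j - e) (x ord0 j) ltac:(by rewrite ltrBlDr ltrDl).
  have [q] := @rat_in_itvoo R (x ord0 j) (x ord0 j + e) ltac:(by rewrite ltrDl).
  rewrite !in_itv/= => /andP[q1 q2] /andP[p1 p2]; exists (p, q) => /=.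
  rewrite p2 q1; split=> // t /andP[pt tq]; apply: sub.
  rewrite /ball/= ltr_norml; apply/andP; split; lra.
have [pq pqP] := fin_all_exists bnd.
exists (@pickle bounds (Some (\row_j (pq j).1, \row_j (pq j).2))); rewrite /rational_box pickleK/=.
  by move=> j; rewrite !mxE; have [] := pqP j.
move=> y yb; apply: WU => i j; rewrite ord1; have [_] := pqP j; apply => /=.
by have := yb j; rewrite !mxE.
Qed.

Lemma open_rational_box k : open (rational_box k).
Proof.
rewrite openE /rational_box; case: unpickle => [[[a b]|]|] // x /= xab.
pose W (i : 'I_1) (j : 'I_n) := [set t : R | (ratr (a ord0 j) < t < ratr (b ord0 j))%R].
exists W; last by move=> y Wy i; exact: Wy.
move=> i j; rewrite ord1 /W; have /andP[h1 h2] := xab j.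
have -> : [set t : R | (ratr (a ord0 j) < t < ratr (b ord0 j))%R] =
    `]ratr (a ord0 j), ratr (b ord0 j)[%classic.
  by apply/seteqP; split => t /=; rewrite in_itv.
by apply: open_nbhs_nbhs; split; [exact: interval_open|rewrite /= in_itv/= h1].
Qed.

Lemma measurable_rational_box k : measurable (rational_box k).
Proof. by apply: sub_gen_smallest; exact: open_rational_box. Qed.

Let rational_boxE k : rational_box k = set0 \/ exists a b : 'rV[rat]_n,
  rational_box k =
  [set x | forall i, (ratr (a ord0 i) < x ord0 i < ratr (b ord0 i))%R].
Proof.
rewrite /rational_box; case: unpickle => [[[a b]|]|]; [right|by left..].
by exists a, b.
Qed.

Lemma setI_closed_rational_box : setI_closed (range rational_box).
Proof.
have box0 : range rational_box set0.
  by exists (@pickle bounds None) => //; rewrite /rational_box pickleK.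
have ratr_max (p q : rat) : ratr (Num.max p q) = Num.max (ratr p) (ratr q) :> R.
  by case: (leP p q) => pq; apply/esym; [apply/max_idPr|apply/max_idPl];
    rewrite ler_rat ?(ltW pq).
have ratr_min (p q : rat) : ratr (Num.min p q) = Num.min (ratr p) (ratr q) :> R.
  by case: (leP p q) => pq; apply/esym; [apply/min_idPl|apply/min_idPr];
    rewrite ler_rat ?(ltW pq).
move=> _ _ [k _ <-] [l _ <-].
have [->|[a [b ->]]] := rational_boxE k; first by rewrite set0I.
have [->|[a' [b' ->]]] := rational_boxE l; first by rewrite setI0.
exists (@pickle bounds (Some (\row_j Num.max (a ord0 j) (a' ord0 j),
                      \row_j Num.min (b ord0 j) (b' ord0 j)))) => //.
rewrite /rational_box pickleK /=; apply/seteqP; split => x /=.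
  move=> h; split=> i; have := h i; rewrite !mxE !ratr_max !ratr_min;
  by rewrite gt_max lt_min => /andP[/andP[h1 h2] /andP[h3 h4]]; apply/andP.
move=> [h h'] i; rewrite !mxE ratr_max ratr_min gt_max lt_min.
have /andP[h1 h2] := h i; have /andP[h3 h4] := h' i.
by rewrite h1 h2 h3 h4.
Qed.

Lemma measurable_rational_boxes :
  @measurable _ (vec R n) = <<s range rational_box >>.
Proof.
apply/seteqP; split; apply: smallest_sub.
- exact: smallest_sigma_algebra.
- move=> U oU.
  have -> : U = \bigcup_(k in [set k | rational_box k `<=` U]) rational_box k.
    apply/seteqP; split => [x Ux|x [k /= kU /kU]//].
    have [k xk kU] := nbhs_rational_box (open_nbhs_nbhs (conj oU Ux)).
    by exists k.
  rewrite bigcup_mkcond; apply: sigma_algebra_bigcup => k.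
  case: ifP => _; last exact: sigma_algebra0.
  by apply: sub_gen_smallest; exists k.
- exact: smallest_sigma_algebra.
- by move=> _ [k _ <-]; exact: measurable_rational_box.
Qed.

End rational_boxes.

(** * Measurability and boundedness from continuity on compact sets *)

Section vec_product.
Variables (R : realType) (m n : nat).
Local Notation TX := (vec R m).
Local Notation TY := (vec R n).

Lemma open_measurable_vec (U : set TY) : open U -> measurable U.
Proof. by move=> oU; exact: sub_gen_smallest. Qed.

Lemma compact_measurable_vec (A : set TY) : compact A -> measurable A.
Proof.
move=> cA; rewrite -(setCK A); apply: measurableC; apply: open_measurable_vec.
rewrite openC; apply: compact_closed cA.
exact: (@norm_hausdorff _ ('rV[R]_n)).
Qed.

(** An open set is a countable union of products of rational boxes. This is what makes a continuous
    cost measurable for the product sigma-algebra. *)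
Lemma open_measurable_prod (U : set (TX * TY)) : open U -> measurable U.
Proof.
move=> oU.
pose B (k l : nat) := @rational_box R m k `*` @rational_box R n l.
have -> : U = \bigcup_k \bigcup_l (if `[< B k l `<=` U >] then B k l else set0).
  apply/seteqP; split => [[x y] Uxy|z [k _ [l _]]]; last first.
    by case: ifPn => // /asboolP; apply.
  have [[V W] /= [nV nW] VW] := open_nbhs_nbhs (conj oU Uxy).
  have [k xk kV] := nbhs_rational_box nV.
  have [l yl lW] := nbhs_rational_box nW.
  exists k => //; exists l => //; case: ifPn => [_|/asboolP]; first by split.
  by case=> -[x' y'] [/= /kV Vx /lW Wy]; exact: VW.
apply: bigcupT_measurable => k; apply: bigcupT_measurable => l.
by case: ifP => // _; apply: measurableX; exact: measurable_rational_box.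
Qed.

End vec_product.

Section continuous_measurable.
Context d (T : measurableType d) (S : topologicalType) (R : realType).

(** [phi] will be the identity: it links the measurable and the topological structure carried by one
    type. *)
Lemma measurable_fun_within_continuous (phi : T -> S) (D : set S) (f : S -> R) :
  (forall U, open U -> measurable (phi @^-1` U)) -> measurable (phi @^-1` D) ->
  {within D, continuous f} -> measurable_fun setT (f \_ D \o phi).
Proof.
move=> mo mD /continuousP cf.
have -> : f \_ D \o phi = (f \o phi) \_ (phi @^-1` D).
  by apply/funext => x; rewrite /= !patchE.
apply/(measurable_restrictT _ mD).1.
apply: (measurability _ (RGenOpens.measurableE R)).
move=> _ [_ [a [b ->] <-]].
have /cf/open_subspaceP[V oV VE] : open `]a, b[%classic by exact: interval_open.
rewrite [X in measurable X](_ : _ = phi @^-1` (V `&` D)).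
  by rewrite preimage_setI; apply: measurableI => //; exact: mo.
by rewrite VE preimage_setI setIC.
Qed.

Lemma compact_within_continuous_bounded (D : set S) (f : S -> R) :
  compact D -> {within D, continuous f} ->
  exists M, forall x, (`|(f \_ D) x| <= M)%R.
Proof.
move=> cD cf; have := continuous_compact cf cD.
move=> /(@compact_bounded R R^o)[M [_ Mf]].
exists (`|M| + 1)%R => x; rewrite patchE; case: ifPn => xD; last first.
  by rewrite normr0 addr_ge0.
apply: (Mf (`|M| + 1)%R); first by rewrite ltr_pwDr// ler_norm.
by exists x => //; exact/set_mem.
Qed.

End continuous_measurable.

(** * Compact sets have finite Lebesgue measure *)

Section lebesgue_compact.
Variables (R : realType) (n : nat).

Lemma measurable_halfopen_box (a b : 'rV[R]_n) :
  measurable [set x : vec R n | forall i, (a ord0 i < x ord0 i <= b ord0 i)%R].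
Proof.
rewrite [X in measurable X](_ : _ = \bigcap_(i in [set: 'I_n])
    ((fun x : vec R n => x ord0 i) @^-1` `]a ord0 i, b ord0 i]%classic)); last first.
  apply/seteqP; split => x /= h i; first by move=> _; rewrite /= in_itv/= h.
  by have := h i I; rewrite /= in_itv.
apply: fin_bigcap_measurable => [|i _]; first exact: finite_finset.
rewrite -[X in measurable X]setTI.
have mc : measurable_fun setT (fun x : vec R n => x ord0 i).
  apply: (measurability _ (RGenOpens.measurableE R)).
  move=> _ [_ [p [q ->] <-]]; rewrite setTI; apply: open_measurable_vec.
  have /continuousP := @coord_continuous R 1 n ord0 i.
  by apply; exact: interval_open.
by apply: mc => //; exact: measurable_itv.
Qed.

Lemma lebesgue_compact_lty (leb : {measure set (vec R n) -> \bar R})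
  (Y : set (vec R n)) : is_lebesgue leb -> compact Y -> leb Y < +oo.
Proof.
move=> isleb cY.
have [M [_ MY]] := @compact_bounded R 'rV[R]_n Y cY.
(* Coordinates on [Y] are at most |M| + 1 in absolute value; one more unit makes the lower bound
   strict, the box being open on the left. *)
pose b : 'rV[R]_n := \row_j (`|M| + 2)%R.
have ab i : ((- b) ord0 i <= b ord0 i)%R.
  by rewrite !mxE; have := normr_ge0 M; lra.
apply: (@le_lt_trans _ _
  (leb [set x | forall i, ((- b) ord0 i < x ord0 i <= b ord0 i)%R])); last first.
  by rewrite isleb// ltry.
apply: le_measure; rewrite ?inE; [exact: compact_measurable_vec|exact: measurable_halfopen_box|].
move=> x Yx /= i; rewrite !mxE.
have xM : (`|x ord0 i| <= `|M| + 1)%R.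
  apply: le_trans (MY (`|M| + 1)%R _ x Yx); last by rewrite ltr_pwDr// ler_norm.
  rewrite [leRHS]/Num.norm/= mx_normrE.
  by apply/bigmax_geP; right; exists (ord0, i).
by move: xM; rewrite ler_norml => /andP[]; lra.
Qed.

End lebesgue_compact.

Lemma integrable_bounded d (T : measurableType d) (R : realType)
    (mu : probability T R) (h : T -> R) (M : R) :
  measurable_fun setT h -> (forall x, (`|h x| <= M)%R) ->
  mu.-integrable setT (EFin \o h).
Proof.
move=> mh hM; apply/integrableP; split; first exact/measurable_EFinP.
apply: (@le_lt_trans _ _ (\int[mu]_x (cst M%:E x))).
  apply: ge0_le_integral => //.
  - by apply: measurableT_comp => //; exact/measurable_EFinP.
  - by move=> x _; rewrite lee_fin.
rewrite integral_cst//; apply: lte_mul_pinfty => //.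
  by rewrite lee_fin (le_trans _ (hM point)).
by apply: (le_lt_trans (probability_le1 mu measurableT)); rewrite ltry.
Qed.

Lemma ge0_integral_mrestr d (T : measurableType d) (R : realType)
    (mu : {measure set T -> \bar R}) (D : set T) (mD : measurable D)
    (f : T -> \bar R) : measurable_fun setT f -> (forall x, 0 <= f x) ->
  \int[mrestr mu mD]_x f x = \int[mu]_(x in D) f x.
Proof.
move=> mf f0; rewrite [LHS](ge0_integral_density (mrestr_density mu mD))//.
by rewrite [RHS]integral_mkcond epatch_indic.
Qed.

Lemma diff_entropyE (R : realType) (n : nat)
    (leb mu : set (vec R n) -> \bar R) : diff_entropy leb mu = - KL mu leb.
Proof. by rewrite /diff_entropy /KL; case: pselect. Qed.

(** * The entropic cost of a coupling *)

Section entropic_transport.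
Variables (R : realType) (m n : nat).
Local Notation TX := (vec R m).
Local Notation TY := (vec R n).
Variables (leb : {measure set TY -> \bar R}) (X : set TX) (Y : set TY).
Variables (c : TX * TY -> R) (eps : R).
Variables (P : probability TX R) (Q : probability TY R).
Variable pi : probability (TX * TY)%type R.
Hypotheses (mX : measurable X) (mY : measurable Y) (lebY : leb Y < +oo).
Hypotheses (PX : P (~` X) = 0) (QY : Q (~` Y) = 0) (eps0 : (0 < eps)%R).
Hypothesis cpl : is_coupling P Q pi.

Let cXY := c \_ (X `*` Y).
Variable C : R.
Hypotheses (mc : measurable_fun setT cXY) (cC : forall z, (`|cXY z| <= C)%R).

Let nu : {finite_measure set TY -> \bar R} := mfrestr mY lebY.

Let integral_cost : \int[pi]_(z in X `*` Y) (c z)%:E = \int[pi]_z (cXY z)%:E.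
Proof.
rewrite integral_mkcond; apply: eq_integral => z _.
by rewrite /cXY !patchE; case: ifP.
Qed.

Let integrable_cost : pi.-integrable setT (EFin \o cXY).
Proof. exact: integrable_bounded mc cC. Qed.

Let integral_cost_fin : \int[pi]_z (cXY z)%:E \is a fin_num.
Proof. exact: integrable_fin_num. Qed.

(** The second marginal is carried by [Y], hence so is almost every conditional. *)
Let conditional_entropy kappa : is_conditional P pi kappa ->
  {ae P, forall x, diff_entropy leb (kappa x) = - KL (kappa x) nu}.
Proof.
move=> [mk pik]; have mE : measurable ([set: TX] `*` ~` Y).
  by apply: measurableX => //; exact: measurableC.
have piY : pi (setT `*` ~` Y) = 0.
  by have [_ ->//] := cpl; exact: measurableC.
apply: filterS (conditional_ae_null mk pik mE piY) => x.
rewrite in_xsectionX ?inE// => kY.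
by rewrite diff_entropyE (KL_mrestr leb mY kY).
Qed.

(** The cost is bounded, and almost every conditional entropy is at most the mass of [nu]. This
    keeps -oo out of the barycenter objective. *)
Lemma EOT_obj_gtNy : -oo < EOT_obj leb X Y c eps P pi.
Proof.
have [r rP] : exists r : R, forall kappa, is_conditional P pi kappa ->
    \int[P]_x diff_entropy leb (kappa x) <= r%:E.
  exists (fine (nu setT)) => kappa ck.
  apply: (@le_trans _ _ (\int[P]_x nu setT)).
    apply: ae_le_integral; apply: filterS (conditional_entropy ck) => x -> _.
    by rewrite leeNl; exact: KL_ge.
  rewrite integral_cst// fineK ?fin_num_measure//.
  by rewrite -[leRHS]mule1 lee_wpmul2l//; exact: probability_le1.
apply: (@lt_le_trans _ _ (\int[pi]_z (cXY z)%:E - (eps * r)%:E)).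
  by rewrite ltNye_eq fin_numB integral_cost_fin.
apply: le_ereal_inf_tmp => _ [kappa ck <-]; rewrite integral_cost.
by apply: leeB => //; rewrite EFinM lee_pmul2l// rP.
Qed.

(** One version of the conditional with finite value produces G. Every version with finite value
    then has the value expressed through this G, and those of value +oo do not affect the
    infimum. *)
Lemma EOT_objE : EOT_obj leb X Y c eps P pi < +oo ->
  exists G, [/\ is_density pi (P \x nu) G,
    pi.-integrable setT (fun z => (ln (G z))%:E) &
    EOT_obj leb X Y c eps P pi =
      \int[pi]_z (cXY z)%:E + eps%:E * \int[pi]_z (ln (G z))%:E].
Proof.
move=> obj_lt.
pose obj kappa := \int[pi]_(z in X `*` Y) (c z)%:E
                 - eps%:E * \int[P]_x diff_entropy leb (kappa x).
(* The cost being finite, an entropy integral equal to -oo would make the objective +oo. *)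
have entNy kappa : obj kappa < +oo -> -oo < \int[P]_x diff_entropy leb (kappa x).
  rewrite /obj integral_cost ltNge => olt; rewrite ltNye; apply: contra olt => /eqP ->.
  by rewrite gt0_muleNy ?lte_fin//= addey// -ltNye ltNye_eq integral_cost_fin.
have [kappa ck olt] : exists2 kappa, is_conditional P pi kappa & obj kappa < +oo.
  apply: contrapT => no; move: obj_lt; rewrite ltNge => /negP; apply.
  apply: le_ereal_inf_tmp => _ [kappa ck <-]; rewrite leNgt; apply/negP => olt.
  by apply: no; exists kappa.
have [G dG] : exists G, is_density pi (P \x nu) G.
  have [mk pik] := ck; apply: (conditional_density_exists mk pik _ (entNy _ olt)).
  apply: filterS (conditional_entropy ck) => x -> ndom.
  rewrite /KL; case: pselect => // -[g dg]; case: ndom.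
  exact: density_dominates dg.
have key kappa' : is_conditional P pi kappa' -> obj kappa' < +oo ->
    pi.-integrable setT (fun z => (ln (G z))%:E) /\
    obj kappa' = \int[pi]_z (cXY z)%:E + eps%:E * \int[pi]_z (ln (G z))%:E.
  move=> ck' olt'; have [mk pik] := ck'.
  have dk := conditional_density mk pik dG (@measurable_rational_boxes R n)
    (@setI_closed_rational_box R n).
  have [iL eL] := integral_KL_conditional dG dk (conditional_entropy ck') (entNy _ olt').
  by split=> //; rewrite /obj integral_cost eL muleN oppeK.
have [iL oE] := key _ ck olt; exists G; split=> //.
apply/eqP; rewrite eq_le; apply/andP; split.
  by rewrite -oE; apply: ereal_inf_lbound; exists kappa.
apply: le_ereal_inf_tmp => _ [kappa' ck' <-]; rewrite -/(obj kappa').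
have [->|] := eqVneq (obj kappa') +oo; first by rewrite leey.
by rewrite -ltey => olt'; have [_ ->] := key _ ck' olt'.
Qed.

End entropic_transport.

Lemma measurable_EFin_restrict d (T : measurableType d) (R : realType)
    (D : set T) (g : T -> R) : measurable D -> measurable_fun setT g ->
  measurable_fun setT ((EFin \o g) \_ D).
Proof.
move=> mD mg; apply/(measurable_restrictT _ mD).1/measurable_funTS.
exact/measurable_EFinP.
Qed.

Lemma measurable_fun_slice d1 d2 (T1 : measurableType d1)
    (T2 : measurableType d2) (R : realType) (g : T1 * T2 -> \bar R) (x : T1) :
  measurable_fun setT g -> measurable_fun setT (fun y => g (x, y)).
Proof. by move=> mg; exact: measurableT_comp. Qed.

Lemma measure_of_bounded_density d1 d2 (T1 : measurableType d1)
    (T2 : measurableType d2) (R : realType) (P : probability T1 R)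
    (nu : {finite_measure set T2 -> \bar R}) (h : T1 * T2 -> R) (B : R) :
  measurable_fun setT h -> (forall z, (0 <= h z)%R) ->
  (forall z, (h z <= B)%R) ->
  exists M : {finite_measure set (T1 * T2)%type -> \bar R},
    is_density M (P \x nu) h.
Proof.
move=> mh h0 hB; apply: (measure_of_density (mu := P \x nu)) => //.
apply: (@le_lt_trans _ _ (\int[P \x nu]_z (cst B%:E z))).
  apply: ge0_le_integral => //.
  - by move=> z _; rewrite lee_fin.
  - exact/measurable_EFinP.
  by move=> z _; rewrite /= lee_fin.
rewrite [ltLHS]integral_cst//; apply: lte_mul_pinfty => //.
  by rewrite lee_fin (le_trans (h0 point)).
rewrite -setXTT [ltLHS]product_measure1E//.
by rewrite lte_mul_pinfty// ?fin_num_measure// ltey_eq fin_num_measure.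
Qed.

(** * The coupling [pi_f] and the gap identity for one marginal *)

Section gibbs.
Variables (R : realType) (m n : nat).
Local Notation TX := (vec R m).
Local Notation TY := (vec R n).
Variables (leb : {measure set TY -> \bar R}) (X : set TX) (Y : set TY).
Variables (c : TX * TY -> R) (eps : R) (f : TY -> R).
Variable P : probability TX R.
Hypotheses (mX : measurable X) (mY : measurable Y) (lebY : leb Y < +oo).
Hypotheses (lebY0 : 0 < leb Y) (PX : P (~` X) = 0) (eps0 : (0 < eps)%R).

Let cXY := c \_ (X `*` Y).
Let fY := f \_ Y.
Variables C F : R.
Hypotheses (mc : measurable_fun setT cXY) (cC : forall z, (`|cXY z| <= C)%R).
Hypotheses (mf : measurable_fun setT fY) (fF : forall y, (`|fY y| <= F)%R).

Let nu : {finite_measure set TY -> \bar R} := mfrestr mY lebY.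

Let integral_nu (g : TY -> \bar R) : measurable_fun setT g ->
  (forall y, 0 <= g y) -> \int[nu]_y g y = \int[leb]_(y in Y) g y.
Proof. exact: ge0_integral_mrestr. Qed.

Let w (z : TX * TY) : R := ((fY z.2 - cXY z) / eps)%R.

Let mw : measurable_fun setT w.
Proof.
apply: measurable_funM => //; apply: measurable_funB => //.
exact: measurableT_comp.
Qed.

(** Bounds the exponent [w], so that Z lies between exp(- W) v and exp(W) v and ln Z is bounded. *)
Let W := ((F + C) / eps)%R.

Let w_le z : (`|w z| <= W)%R.
Proof.
rewrite /w /W normrM normfV (gtr0_norm eps0) ler_pM2r ?invr_gt0//.
by apply: (le_trans (ler_normB _ _)); rewrite lerD.
Qed.

Let Z (x : TX) : \bar R := \int[nu]_y (expR (w (x, y)))%:E.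

Let mexpw x : measurable_fun setT (fun y => (expR (w (x, y)))%:E).
Proof.
apply/measurable_EFinP; apply: measurableT_comp; first exact: measurable_expR.
exact: measurableT_comp.
Qed.

Let v := fine (leb Y).

Let v0 : (0 < v)%R.
Proof. by rewrite fine_gt0// lebY0. Qed.

Let nuT : nu setT = v%:E.
Proof.
by rewrite /nu/= /mfrestr /mrestr setTI /v fineK// ge0_fin_numE.
Qed.

Let Z_ge x : (expR (- W) * v)%:E <= Z x.
Proof.
rewrite EFinM -nuT -integral_cst//; apply: ge0_le_integral => //.
- by move=> y _; rewrite /= lee_fin expR_ge0.
by move=> y _; rewrite /= lee_fin ler_expR; have := w_le (x, y); rewrite ler_norml => /andP[].
Qed.

Let Z_le x : Z x <= (expR W * v)%:E.
Proof.
rewrite EFinM -nuT -integral_cst//; apply: ge0_le_integral => //.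
by move=> y _; rewrite /= lee_fin ler_expR; have := w_le (x, y); rewrite ler_norml => /andP[].
Qed.

Let Z_fin x : Z x \is a fin_num.
Proof.
rewrite ge0_fin_numE; first by apply: (le_lt_trans (Z_le x)); rewrite ltry.
by apply: integral_ge0 => y _; rewrite lee_fin expR_ge0.
Qed.

Let z_ge x : (expR (- W) * v <= fine (Z x))%R.
Proof. by rewrite -lee_fin fineK. Qed.

Let z_le x : (fine (Z x) <= expR W * v)%R.
Proof. by rewrite -lee_fin fineK. Qed.

Let z_gt0 x : (0 < fine (Z x))%R.
Proof. by apply: (lt_le_trans _ (z_ge x)); rewrite mulr_gt0// expR_gt0. Qed.

Let lnz (x : TX) : R := ln (fine (Z x)).

Let mlnz : measurable_fun setT lnz.
Proof.
apply: measurableT_comp; first exact: measurable_ln.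
apply: measurableT_comp => //.
apply: (@measurable_fun_fubini_tonelli_F _ _ TX TY R nu (fun z => (expR (w z))%:E)).
- by apply/measurable_EFinP; apply: measurableT_comp; first exact: measurable_expR.
- by move=> z; rewrite lee_fin expR_ge0.
Qed.

Let lnz_le x : (`|lnz x| <= W + `|ln v|)%R.
Proof.
have h1 : (ln (expR (- W) * v) <= lnz x)%R.
  by rewrite ler_ln ?posrE ?mulr_gt0 ?expR_gt0.
have h2 : (lnz x <= ln (expR W * v))%R.
  by rewrite ler_ln ?posrE ?mulr_gt0 ?expR_gt0.
rewrite lnM ?posrE ?expR_gt0// expRK in h1.
rewrite lnM ?posrE ?expR_gt0// expRK in h2.
have := ler_norm (ln v); have := ler_norm (- ln v)%R; rewrite normrN.
by rewrite ler_norml; lra.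
Qed.

(** Logarithm of the density of [pi_f] relative to [P \x nu]. *)
Let theta (z : TX * TY) : R := (w z - lnz z.1)%R.

Let mtheta : measurable_fun setT theta.
Proof.
apply: measurable_funB; first exact: mw.
exact: (measurableT_comp mlnz measurable_fst).
Qed.

Let theta_le z : (`|theta z| <= W + (W + `|ln v|))%R.
Proof. by apply: (le_trans (ler_normB _ _)); rewrite lerD. Qed.

Let mexpt : measurable_fun setT (expR \o theta).
Proof. by apply: measurableT_comp; first exact: measurable_expR. Qed.

Let PX_ae : {ae P, forall x, X x}.
Proof. by exists (~` X); split => //; exact: measurableC. Qed.

(** Outside [X] the exponent [w] uses the cost set to 0; [X] has full [P]-measure, so agreement on
    [X] suffices under integrals. *)
Let ZcE x : X x -> Zc leb Y c eps f x = Z x.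
Proof.
move=> Xx; rewrite /Z [RHS](integral_nu (mexpw x))//.
apply: eq_integral => y yY; rewrite /w /= /fY /cXY !patchE yY in_setX yY andbT.
by rewrite (mem_set Xx).
Qed.

Lemma integral_ctransform :
  \int[P]_(x in X) (ctransform leb Y c eps f x)%:E =
  \int[P]_x (- eps * lnz x)%:E.
Proof.
rewrite integral_mkcond; apply: eq_ae_integral.
apply: filterS PX_ae => x Xx _; rewrite patchE (mem_set Xx).
by rewrite /ctransform ZcE.
Qed.

Let pi_fE E : measurable E -> pi_f leb Y c eps P f E =
  \int[P \x nu]_(z in E) (expR (theta z))%:E.
Proof.
move=> mE.
have mF : measurable_fun setT ((EFin \o (expR \o theta)) \_ E).
  exact: measurable_EFin_restrict.
have F0 z : 0 <= ((EFin \o (expR \o theta)) \_ E) z.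
  by rewrite patchE; case: ifP => // _; rewrite lee_fin expR_ge0.
rewrite [RHS]integral_mkcond [RHS]fubini_tonelli1//.
apply: eq_ae_integral; apply: filterS PX_ae => x Xx _.
rewrite /fubini_F [RHS](integral_nu (measurable_fun_slice x mF))//.
rewrite integral_mkcondr; apply: eq_integral => y yY.
rewrite !patchE mem_xsection; case: ifP => // _.
rewrite /mu_dens ZcE//= /theta/= expRD expRN lnK ?posrE//.
rewrite /w /= /fY /cXY !patchE yY in_setX yY andbT.
by rewrite (mem_set Xx).
Qed.

Let pi_f_measure : exists M : {finite_measure set (TX * TY)%type -> \bar R},
  is_density M (P \x nu) (expR \o theta).
Proof.
apply: (measure_of_bounded_density P nu (B := expR (W + (W + `|ln v|)))) => //.
  by move=> z; exact: expR_ge0.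
move=> z; rewrite /= ler_expR; exact: le_trans (ler_norm _) (theta_le z).
Qed.

Section coupling.
Variables (Q : probability TY R) (pi : probability (TX * TY)%type R).
Hypotheses (QY : Q (~` Y) = 0) (cpl : is_coupling P Q pi).

Lemma KL_marginal_le :
  KL Q (Q_f leb Y c eps P f) <= KL pi (pi_f leb Y c eps P f).
Proof.
have [M dM] := pi_f_measure.
have ME E : measurable E -> pi_f leb Y c eps P f E = M E.
  by move=> mE; have [_ [_ ->//]] := dM; rewrite pi_fE.
rewrite [leRHS](KL_eq (nu' := M) (fun _ _ => erefl) ME).
apply: (KL_pushforward_le (phi := snd)) => //.
- by move=> B mB; have [_ <-//] := cpl; rewrite setTX.
- by move=> B mB; rewrite /Q_f ME ?setTX//; rewrite -setTX; exact: measurableX.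
Qed.

(** ln G is integrable and the other terms are bounded, so all values are real and oo - oo cannot
    occur. Integrate ln G - theta = ln G + (c - f) / eps + ln Z against [pi]; its marginals turn the
    terms in ln Z and f into integrals under [P] and [Q]. *)
Lemma dual_gap_marginal : EOT_obj leb X Y c eps P pi < +oo ->
  exists e k t q : R, [/\ EOT_obj leb X Y c eps P pi = e%:E,
    KL pi (pi_f leb Y c eps P f) = k%:E,
    \int[P]_(x in X) (ctransform leb Y c eps f x)%:E = t%:E,
    \int[Q]_y (fY y)%:E = q%:E & (eps * k = e - t - q)%R].
Proof.
move=> /(EOT_objE mY lebY QY eps0 cpl mc cC)[G [dG iL eE]].
have [M dM] := pi_f_measure.
have ME E : measurable E -> pi_f leb Y c eps P f E = M E.
  by move=> mE; have [_ [_ ->//]] := dM; rewrite pi_fE.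
have kE : KL pi (pi_f leb Y c eps P f) = \int[pi]_z (ln (G z) - theta z)%:E.
  rewrite (KL_eq (nu' := M) (fun _ _ => erefl) ME).
  exact: KL_exp_density dG mtheta dM.
have ic : pi.-integrable setT (EFin \o cXY) := integrable_bounded pi mc cC.
have mlnz1 : measurable_fun setT (lnz \o (@fst TX TY)) by exact: measurableT_comp.
have iz : pi.-integrable setT (EFin \o (lnz \o (@fst TX TY))).
  by apply: (integrable_bounded pi mlnz1) => z; exact: lnz_le.
have mf2 : measurable_fun setT (fY \o (@snd TX TY)) by exact: measurableT_comp.
have if_ : pi.-integrable setT (EFin \o (fY \o (@snd TX TY))).
  by apply: (integrable_bounded pi mf2) => z; exact: fF.
have it : pi.-integrable setT (EFin \o theta).
  by apply: (integrable_bounded pi mtheta) => z; exact: theta_le.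
have zE : \int[P]_x (lnz x)%:E = \int[pi]_z (lnz z.1)%:E.
  apply: (integral_pushforwardT (f := EFin \o lnz) measurable_fst) => //.
    by apply/measurable_EFinP; exact: mlnz.
  by move=> B mB; rewrite -setXT; have [cplP _] := cpl; exact/esym/cplP.
have qE : \int[Q]_y (fY y)%:E = \int[pi]_z (fY z.2)%:E.
  apply: (integral_pushforwardT (f := EFin \o fY) measurable_snd) => //.
    by apply/measurable_EFinP; exact: mf.
  by move=> B mB; rewrite -setTX; have [_ cplQ] := cpl; exact/esym/cplQ.
have fin h : pi.-integrable setT (EFin \o h) ->
    exists r : R, \int[pi]_z (h z)%:E = r%:E.
  move=> ih; exists (fine (\int[pi]_z (h z)%:E)).
  by rewrite fineK//; exact: (integrable_fin_num measurableT ih).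
have [rc rcE] := fin _ ic; have [rz rzE] := fin _ iz.
have [rf rfE] := fin _ if_; have [rL rLE] := fin _ iL; have [rt rtE] := fin _ it.
have izP : P.-integrable setT (EFin \o lnz) := integrable_bounded P mlnz lnz_le.
exists (rc + eps * rL)%R, (rL - rt)%R, (- eps * rz)%R, rf; split.
- by rewrite eE rcE rLE.
- rewrite kE; under eq_integral do rewrite EFinB.
  by rewrite integralB//= rLE rtE.
- rewrite integral_ctransform; under eq_integral do rewrite EFinM.
  by rewrite (integralZl measurableT izP) zE rzE.
- by rewrite qE rfE.
have : rt%:E = (eps^-1 * (rf - rc) - rz)%:E.
  rewrite EFinB EFinM EFinB -rtE -rzE -rfE -rcE.
  rewrite -integralB// -integralZl//; last exact: integrableB.
  rewrite -integralB//; last by apply: integrableZl => //; exact: integrableB.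
  apply: eq_integral => z _; rewrite /theta /w mulrC.
  by rewrite EFinB EFinM EFinB.
move=> [->]; rewrite !mulrBr mulVKf ?gt_eqF// mulVKf ?gt_eqF//; ring.
Qed.

End coupling.
End gibbs.

(** * Weighted summation over the marginals *)

Unset Implicit Arguments.
Set Strict Implicit.
Set Printing Implicit Defensive.
Local Close Scope ereal_scope.

Theorem theorem2 (R : realType) (K : nat) (D : 'I_K -> nat) (n : nat)
  (lebX : forall k : 'I_K, {measure set (vec R (D k)) -> \bar R})
  (leb : {measure set (vec R n) -> \bar R})
  (X : forall k : 'I_K, set (vec R (D k))) (Y : set (vec R n))
  (P : forall k : 'I_K, probability (vec R (D k)) R)
  (c : forall k : 'I_K, (vec R (D k) * vec R n)%type -> R)
  (lam : 'I_K -> R) (eps : R)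
  (Qstar : probability (vec R n) R)
  (pistar : forall k : 'I_K, probability (vec R (D k) * vec R n)%type R)
  (f : 'I_K -> vec R n -> R) :
  (0 < K)%N ->
  (forall k, is_lebesgue (lebX k)) -> is_lebesgue leb ->
  (forall k, compact (X k)) -> compact Y -> (0 < leb Y)%E ->
  (forall k, P k (~` X k) = 0%E) ->
  (forall k, P k `<< lebX k) ->
  (forall k, {within X k `*` Y, continuous (c k)}) ->
  (forall k, 0 < lam k) -> \sum_(k < K) lam k = 1 ->
  0 < eps ->
  let Bobj := fun Q : probability (vec R n) R =>
    (\sum_(k < K) (lam k)%:E * EOT leb (X k) Y (c k) eps (P k) Q)%E in
  let Lstar := ereal_inf [set Bobj Q | Q in
                 [set Q : probability (vec R n) R | Q (~` Y) = 0%E]] in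
  (exists Q : probability (vec R n) R, Q (~` Y) = 0%E /\ Bobj Q \is a fin_num) ->
  (* Q^* is the barycenter *)
  Qstar (~` Y) = 0%E -> Bobj Qstar = Lstar ->
  (* pi_k^* is the optimal coupling in EOT_{c_k,eps}(P_k, Q^* ) *)
  (forall k, is_coupling (P k) Qstar (pistar k) /\
     EOT_obj leb (X k) Y (c k) eps (P k) (pistar k)
       = EOT leb (X k) Y (c k) eps (P k) Qstar) ->
  (* f_1, ..., f_K are continuous on Y and congruent *)
  (forall k, {within Y, continuous (f k)}) ->
  (forall y, Y y -> \sum_(k < K) lam k * f k y = 0) ->
  let Lf := (\sum_(k < K) (lam k)%:E *
       \int[P k]_(x in X k) (ctransform leb Y (c k) eps (f k) x)%:E)%E in
  (Lstar - Lf = eps%:E * \sum_(k < K) (lam k)%:E *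
        KL (pistar k) (pi_f leb Y (c k) eps (P k) (f k)))%E /\
  (eps%:E * \sum_(k < K) (lam k)%:E *
        KL (pistar k) (pi_f leb Y (c k) eps (P k) (f k))
   >= eps%:E * \sum_(k < K) (lam k)%:E *
        KL Qstar (Q_f leb Y (c k) eps (P k) (f k)))%E.
Proof.
move=> K0 _ isleb cX cY leb0 PX _ cc lam0 _ eps0 Bobj Lstar [Q0 [Q0Y Q0fin]].
move=> QY BQ opt cf cong Lf.
have mY := compact_measurable_vec cY.
have mX k := compact_measurable_vec (cX k).
have lebY := lebesgue_compact_lty isleb cY.
have mc k : measurable_fun setT (c k \_ (X k `*` Y)).
  have mXY : measurable (X k `*` Y) by apply: measurableX; [exact: mX|exact: mY].
  exact: (@measurable_fun_within_continuous _ (vec R (D k) * vec R n)%type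
    (vec R (D k) * vec R n)%type R id _ _
    (fun U oU => open_measurable_prod oU) mXY (cc k)).
have /choice[C cC] : forall k, exists C, forall z, `|(c k \_ (X k `*` Y)) z| <= C.
  move=> k; apply: compact_within_continuous_bounded (cc k).
  exact: compact_setX (cX k) cY.
have mf k : measurable_fun setT (f k \_ Y).
  exact: (@measurable_fun_within_continuous _ (vec R n) (vec R n) R id _ _
    (fun U oU => open_measurable_vec oU) mY (cf k)).
have /choice[F fF] : forall k, exists F, forall y, `|(f k \_ Y) y| <= F.
  by move=> k; exact: compact_within_continuous_bounded cY (cf k).
have gtNy k : (-oo < EOT leb (X k) Y (c k) eps (P k) Qstar)%E.
  have [cpl <-] := opt k.
  exact: (EOT_obj_gtNy mY lebY QY eps0 cpl (mc k) (cC k)).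
have Blt : (Bobj Qstar < +oo)%E.
  rewrite BQ; apply: (@le_lt_trans _ _ (Bobj Q0)).
    by apply: ereal_inf_lbound; exists Q0.
  by rewrite ltey_eq Q0fin.
(* The weights are positive and no term is -oo, so one infinite term would make the whole sum
   +oo. *)
have lty k : (EOT leb (X k) Y (c k) eps (P k) Qstar < +oo)%E.
  rewrite ltey; apply/eqP => Eoo; move: Blt; rewrite ltey => /eqP; apply.
  apply/esum_eqyP.
    move=> i _; have := gtNy i; case: EOT => [r _|_|]//.
    by rewrite gt0_muley// lte_fin.
  by exists k; split => //; rewrite Eoo gt0_muley ?lte_fin.
have /choice[u uP] : forall k, exists u : R * R * R * R,
    [/\ EOT leb (X k) Y (c k) eps (P k) Qstar = u.1.1.1%:E,
      KL (pistar k) (pi_f leb Y (c k) eps (P k) (f k)) = u.1.1.2%:E,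
      (\int[P k]_(x in X k) (ctransform leb Y (c k) eps (f k) x)%:E)%E = u.1.2%:E,
      (\int[Qstar]_y ((f k \_ Y) y)%:E)%E = u.2%:E &
      eps * u.1.1.2 = u.1.1.1 - u.1.2 - u.2].
  move=> k; have [cpl EE] := opt k.
  have olt : (EOT_obj leb (X k) Y (c k) eps (P k) (pistar k) < +oo)%E by rewrite EE.
  have [e [kl [t [q [eE kE tE qE gap]]]]] := dual_gap_marginal (mX k) mY lebY leb0
    (PX k) eps0 (mc k) (cC k) (mf k) (fF k) QY cpl olt.
  by exists (e, kl, t, q); split=> //=; rewrite -EE.
have EFin_sum (g : 'I_K -> \bar R) (h : 'I_K -> R) : (forall k, g k = (h k)%:E) ->
    (\sum_(k < K) (lam k)%:E * g k)%E = (\sum_(k < K) lam k * h k)%:E.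
  by move=> gh; rewrite -sumEFin; apply: eq_bigr => k _; rewrite gh.
(* The couplings share the second marginal [Qstar], so the integrals combine under one measure; the
   integrand is 0 on [Y] by congruence and elsewhere by restriction. *)
have q0 : \sum_(k < K) lam k * (u k).2 = 0.
  apply: EFin_inj; rewrite -(EFin_sum (fun k => \int[Qstar]_y ((f k \_ Y) y)%:E)%E); last first.
    by move=> k; have [_ _ _ qE _] := uP k.
  have intf k : Qstar.-integrable setT (EFin \o (f k \_ Y)).
    exact: integrable_bounded (mf k) (fF k).
  transitivity (\sum_(k < K) \int[Qstar]_y ((lam k)%:E * ((f k \_ Y) y)%:E))%E.
    by apply: eq_bigr => k _; rewrite -integralZl//; exact: intf.
  rewrite -integral_sum//; last by move=> k; apply: integrableZl => //; exact: intf.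
  apply: integral0_eq => y _; rewrite (eq_bigr (fun k => (lam k * (f k \_ Y) y)%:E))//.
  rewrite sumEFin; congr (_%:E).
  have [yY|yY] := boolP (y \in Y).
    rewrite -[RHS](cong y (set_mem yY)); apply: eq_bigr => k _.
    by rewrite patchE yY.
  by apply: big1 => k _; rewrite patchE (negbTE yY) mulr0.
have LE : Lstar = (\sum_(k < K) lam k * (u k).1.1.1)%:E.
  by rewrite -BQ; apply: EFin_sum => k; have [eE _ _ _ _] := uP k.
have LfE : Lf = (\sum_(k < K) lam k * (u k).1.2)%:E.
  by apply: EFin_sum => k; have [_ _ tE _ _] := uP k.
have kE k : KL (pistar k) (pi_f leb Y (c k) eps (P k) (f k)) = (u k).1.1.2%:E.
  by have [_ kE _ _ _] := uP k.
split.
  rewrite LE LfE (EFin_sum _ _ kE) -EFinM; congr (_%:E).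
  (* Subtracting the vanishing sum [q0] lets the identity be checked for each k separately. *)
  rewrite -[LHS]subr0 -[X in _ - X]q0 -!sumrB mulr_sumr; apply: eq_bigr => k _.
  have [_ _ _ _ gap] := uP k.
  by rewrite mulrCA gap !mulrBr.
apply: lee_wpmul2l; first by rewrite lee_fin ltW.
apply: lee_sum => k _; apply: lee_wpmul2l; first by rewrite lee_fin ltW.
have [cpl _] := opt k.
exact: (KL_marginal_le (mX k) mY lebY leb0 (PX k) eps0 (mc k) (cC k) (mf k) (fF k) cpl).
Qed.
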